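(* Let $m\ge1$ and $n\ge2m+1$ be integers, and let $N^\epsilon_\Lambda$ be the LVMB manifold of a good system $(\epsilon,\Lambda)$ with parameters $(n,m)$ satisfying condition $(K)$: there exists an $\mathbb{R}$-linear automorphism $\Phi$ of $\mathbb{C}^m$ such that $\Phi(\Lambda_j)\in\mathbb{Z}[i]^m$ for every $j\in\{1,\ldots,n\}$. Then there exists a complex torus $\mathbb{T}^m$ of complex dimension $m$ in the automorphism group $\mathrm{Aut}(N^\epsilon_\Lambda,J)$ that is preserved by the complex structure $J$ of $N^\epsilon_\Lambda$.
   Context: Let $m\ge1$ and $n\ge 2m+1$ be integers. A fundamental set $\epsilon$ is a non-empty set of subsets of $\{1,\ldots,n\}$, each of cardinality $2m+1$; its elements are called fundamental parts. A subset of $\{1,\ldots,n\}$ is acceptable if it contains a fundamental part; $\mathcal{A}$ denotes the set of acceptable subsets. A configuration is an $n$-tuple $\Lambda=(\Lambda_1,\ldots,\Lambda_n)\in(\mathbb{C}^m)^n$. The pair $(\epsilon,\Lambda)$ is studyable if for every $\sigma\in\epsilon$ the family $(\Lambda_i)_{i\in\sigma}$ is a real affine frame of $\mathbb{C}^m=\mathbb{R}^{2m}$. $\epsilon$ satisfies (PEUR) if for every $\sigma\in\epsilon$ and every $k\in\{1,\ldots,n\}$ there is a unique $k'\in\sigma$ with $(\sigma\setminus\{k'\})\cup\{k\}\in\epsilon$. A studyable $(\epsilon,\Lambda)$ satisfies the imbrication condition if for all $\sigma,\tau\in\epsilon$ the real convex hulls of $(\Lambda_i)_{i\in\sigma}$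 and $(\Lambda_j)_{j\in\tau}$ have interiors that intersect. A good system is a studyable system satisfying the imbrication condition and (PEUR). For $z\in\mathbb{C}^n$ let $I_z=\{i: z_i\ne0\}$, and let $S^\epsilon=\{z\in\mathbb{C}^n: I_z\in\mathcal{A}\}$. The group $\mathbb{C}^*\times\mathbb{C}^m$ acts on $S^\epsilon$ by $(\alpha,T)\cdot z=(\alpha z_1e^{\langle\Lambda_1,T\rangle},\ldots,\alpha z_ne^{\langle\Lambda_n,T\rangle})$, where $\langle\Lambda_i,T\rangle=\sum_{j=1}^m\lambda_i^jT_j$ for $\Lambda_i=(\lambda_i^1,\ldots,\lambda_i^m)$. For a good system, the quotient $N^\epsilon_\Lambda$ of $S^\epsilon$ by this action is a compact complex manifold of dimension $n-m-1$, called an LVMB manifold. $\mathrm{Aut}(N^\epsilon_\Lambda,J)$ is the group of biholomorphisms of $N^\epsilon_\Lambda$. A complex torus of complex dimension $m$ is a quotient of $\mathbb{C}^m$ by a lattice of rank $2m$. That the torus lies in $\mathrm{Aut}(N^\epsilon_\Lambda,J)$ means that it injects into this group via an effective action on $N^\epsilon_\Lambda$; that it is preserved by $J$ means that its Lie algebra, viewed as a space of vector fields on $N^\epsilon_\Lambda$, is stable under $J$. *)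

(* Defs.v *)
From HB Require Import structures.
From mathcomp Require Import all_boot all_order all_algebra.
From mathcomp Require Import generic_quotient ring_quotient complex.
From mathcomp Require Import all_classical all_reals all_analysis.
From mathcomp Require Import ring.

Set Implicit Arguments.
Unset Strict Implicit.
Unset Printing Implicit Defensive.

Import Order.TTheory GRing.Theory Num.Theory.
Import numFieldNormedType.Exports.

Local Open Scope classical_set_scope.
Local Open Scope ring_scope.
Local Open Scope complex_scope.
Local Open Scope quotient_scope.

(* R[i] as a normed space over itself. Hence ['rV[R[i]]_n] is a normed space   *)
(* over R[i], and [differentiable] between such spaces means                   *)
(* complex-differentiable.                                                     *)
HB.instance Definition _ (R : realType) :=
  NormedModule.copy R[i] (R[i] : numClosedFieldType)^o.

Section ComplexExponential.
Context {R : realType}.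

Definition expC (z : R[i]) : R[i] :=
  (expR (complex.Re z))%:C * (cos (complex.Im z) +i* sin (complex.Im z)).

Lemma expC0 : expC 0 = 1.
Proof. by rewrite /expC /= expR0 cos0 sin0 mul1r. Qed.

Lemma expCD z w : expC (z + w) = expC z * expC w.
Proof.
case: z w => [a b] [c d]; rewrite /expC /= expRD cosD sinD.
by apply/eqP; rewrite eq_complex /=; apply/andP; split; apply/eqP; ring.
Qed.

End ComplexExponential.

Section GoodSystems.
Context {R : realType} {m n : nat}.
Variables (eps : {set {set 'I_n}}) (Lambda : 'I_n -> 'rV[R[i]]_m).

Definition fundamental_set : Prop :=
  eps != finset.set0 /\ forall sigma, sigma \in eps -> #|sigma| = (2 * m + 1)%N.

Definition acceptable (A : {set 'I_n}) : bool :=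
  [exists sigma in eps, sigma \subset A].

Definition real_affine_frame (sigma : {set 'I_n}) : Prop :=
  (forall c : 'I_n -> R,
      \sum_(i in sigma) c i = 0 ->
      \sum_(i in sigma) (c i)%:C *: Lambda i = 0 ->
      forall i, i \in sigma -> c i = 0)
  /\
  (forall x : 'rV[R[i]]_m, exists c : 'I_n -> R,
      \sum_(i in sigma) c i = 1 /\
      x = \sum_(i in sigma) (c i)%:C *: Lambda i).

Definition studyable : Prop :=
  fundamental_set /\ forall sigma, sigma \in eps -> real_affine_frame sigma.

Definition PEUR : Prop :=
  forall sigma, sigma \in eps -> forall k : 'I_n,
    exists! k', k' \in sigma /\ (k |: (sigma :\ k'))%SET \in eps.

Definition real_convex_hull (sigma : {set 'I_n}) : set 'rV[R[i]]_m :=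
  [set x | exists c : 'I_n -> R,
      [/\ forall i, i \in sigma -> 0 <= c i,
          \sum_(i in sigma) c i = 1 &
          x = \sum_(i in sigma) (c i)%:C *: Lambda i]].

Definition imbrication : Prop :=
  forall sigma tau, sigma \in eps -> tau \in eps ->
    (real_convex_hull sigma)° `&` (real_convex_hull tau)° !=set0.

Definition good_system : Prop := [/\ studyable, imbrication & PEUR].

Definition R_linear_automorphism (Phi : 'rV[R[i]]_m -> 'rV[R[i]]_m) : Prop :=
  (forall (r : R) x y, Phi (r%:C *: x + y) = r%:C *: Phi x + Phi y) /\
  bijective Phi.

Definition gaussian_integer (z : R[i]) : Prop :=
  exists a b : int, z = a%:~R +i* b%:~R.

Definition condition_K : Prop :=
  exists Phi : 'rV[R[i]]_m -> 'rV[R[i]]_m,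
    R_linear_automorphism Phi /\
    forall j k, gaussian_integer (Phi (Lambda j) ord0 k).

(* [<Lambda_i, T>] is complex bilinear, not Hermitian. *)
Definition pairing (i : 'I_n) (T : 'rV[R[i]]_m) : R[i] :=
  \sum_(j < m) Lambda i ord0 j * T ord0 j.

Definition Cact (alpha : R[i]) (T : 'rV[R[i]]_m) (z : 'rV[R[i]]_n) :
    'rV[R[i]]_n :=
  \row_i (alpha * z ord0 i * expC (pairing i T)).

Definition Sset : set 'rV[R[i]]_n :=
  [set z | acceptable [set i | z ord0 i != 0]%SET].

Definition orbit_rel : rel (set_type Sset) := fun z w =>
  `[< exists alpha T, alpha != 0 /\ set_val w = Cact alpha T (set_val z) >].

Lemma pairingD i T U : pairing i (T + U) = pairing i T + pairing i U.
Proof.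
by rewrite /pairing -big_split /=; apply: eq_bigr => j _; rewrite mxE mulrDr.
Qed.

Lemma Cact1 z : Cact 1 0 z = z.
Proof.
apply/rowP => i; rewrite mxE /pairing big1 ?expC0 ?mulr1 ?mul1r// => j _.
by rewrite mxE mulr0.
Qed.

Lemma Cact_comp a b T U z : Cact a T (Cact b U z) = Cact (a * b) (T + U) z.
Proof. by apply/rowP => i; rewrite !mxE pairingD expCD; ring. Qed.

Lemma orbit_rel_equiv : equiv_class_of orbit_rel.
Proof.
split=> [z|z w|z w u].
- by apply/asboolP; exists 1, 0; rewrite Cact1 oner_neq0.
- suff sym z' w' : orbit_rel z' w' -> orbit_rel w' z'.
    by apply/idP/idP; exact: sym.
  move=> /asboolP[a [T [a0 zw]]]; apply/asboolP; exists a^-1, (- T).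
  by rewrite zw Cact_comp mulVf// addNr Cact1 invr_eq0.
- move=> /asboolP[a [T [a0 zw]]] /asboolP[b [U [b0 wu]]].
  by apply/asboolP; exists (b * a), (U + T); rewrite wu zw Cact_comp mulf_neq0.
Qed.

Canonical orbit_equiv := EquivRelPack orbit_rel_equiv.
Canonical orbit_encModRel := defaultEncModRel orbit_rel.

Definition LVMB : topologicalType := quotient_topology {eq_quot orbit_rel}.

Definition LVMB_proj : set_type Sset -> LVMB :=
  fun z => \pi_{eq_quot orbit_rel} z.

End GoodSystems.

Section ComplexManifolds.
Context {R : realType} (M : topologicalType) (d : nat).

(* The values of [chart_map] outside [chart_dom], and of [chart_inv] outside   *)
(* [chart_map @` chart_dom], are irrelevant.                                   *)
Record chart := Chart {
  chart_dom : set M;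
  chart_map : M -> 'rV[R[i]]_d;
  chart_inv : 'rV[R[i]]_d -> M }.

Definition chart_img (phi : chart) : set 'rV[R[i]]_d :=
  chart_map phi @` chart_dom phi.

Definition is_chart (phi : chart) : Prop :=
  [/\ open (chart_dom phi), open (chart_img phi),
      forall p, chart_dom phi p -> chart_inv phi (chart_map phi p) = p,
      forall p, chart_dom phi p -> {for p, continuous (chart_map phi)} &
      forall x, chart_img phi x -> {for x, continuous (chart_inv phi)}].

Section Automorphisms.
Variable atlas : set chart.

Definition holomorphic_map (f : M -> M) : Prop :=
  continuous f /\
  forall phi psi, atlas phi -> atlas psi ->
  forall p, chart_dom phi p -> chart_dom psi (f p) ->
    differentiable (chart_map psi \o f \o chart_inv phi) (chart_map phi p).

Definition biholomorphism (f : M -> M) : Prop :=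
  exists g : M -> M,
    [/\ cancel f g, cancel g f, holomorphic_map f & holomorphic_map g].

(* A real tangent vector field, given by its expression in every chart: [X phi *)
(* p], for [p] in the domain of [phi], is the value at [p] read through [phi]. *)
Definition vector_field (X : chart -> M -> 'rV[R[i]]_d) : Prop :=
  forall phi psi, atlas phi -> atlas psi ->
  forall p, chart_dom phi p -> chart_dom psi p ->
    X psi p = 'd (chart_map psi \o chart_inv phi) (chart_map phi p) (X phi p).

Definition J (X : chart -> M -> 'rV[R[i]]_d) : chart -> M -> 'rV[R[i]]_d :=
  fun phi p => 'i *: X phi p.

Definition has_velocity (c : R -> 'rV[R[i]]_d) (v : 'rV[R[i]]_d) : Prop :=
  (fun h : R => (h^-1)%:C *: (c h - c 0)) @ 0^' --> v.

End Automorphisms.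
End ComplexManifolds.

Section LVMBCharts.
Context {R : realType} {m n : nat}.
Variables (eps : {set {set 'I_n}}) (Lambda : 'I_n -> 'rV[R[i]]_m).

Local Notation N := (LVMB eps Lambda).
Local Notation pr := (@LVMB_proj R m n eps Lambda).
Local Notation dimN := (n - m - 1)%N.

(* The (maximal) atlas of the quotient complex structure: the charts in which  *)
(* the projection of [Sset eps] (an open subset of C^n) onto the quotient is   *)
(* holomorphic and has local holomorphic sections, i.e. is a holomorphic       *)
(* submersion. A function on an open subset of N is then holomorphic exactly   *)
(* when its pull-back to [Sset eps] is.                                        *)
Definition LVMB_atlas : set (@chart R N dimN) :=
  [set phi |
    [/\ is_chart phi,
        exists F : 'rV[R[i]]_n -> 'rV[R[i]]_dimN,
          forall z, chart_dom phi (pr z) ->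
            F (set_val z) = chart_map phi (pr z) /\
            differentiable F (set_val z) &
        forall p, chart_dom phi p ->
          exists s : 'rV[R[i]]_dimN -> 'rV[R[i]]_n,
            \forall x \near chart_map phi p,
              differentiable s x /\
              exists2 z, set_val z = s x & pr z = chart_inv phi x]].

End LVMBCharts.
Arguments LVMB_atlas {R m n} eps Lambda.

Section ComplexTori.
Context {R : realType} {m : nat}.

Definition real_free (b : 'I_(2 * m) -> 'rV[R[i]]_m) : Prop :=
  forall c : 'I_(2 * m) -> R,
    \sum_j (c j)%:C *: b j = 0 -> forall j, c j = 0.

Definition lattice (b : 'I_(2 * m) -> 'rV[R[i]]_m) : {pred 'rV[R[i]]_m} :=
  fun x => `[< exists k : 'I_(2 * m) -> int, x = \sum_j b j *~ k j >].

Lemma lattice_zmod_closed b : zmod_closed (lattice b).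
Proof.
split=> [|x y /asboolP[k ->] /asboolP[l ->]]; apply/asboolP.
  by exists (fun=> 0); rewrite big1.
exists (fun j => k j - l j); rewrite -sumrB; apply: eq_bigr => j _.
by rewrite mulrzBr.
Qed.

HB.instance Definition _ b :=
  GRing.isZmodClosed.Build 'rV[R[i]]_m (lattice b) (lattice_zmod_closed b).

(* [C^m / L] as an abelian group; its topology is [quotient_topology]. When    *)
(* [real_free b] holds, [L] is a lattice of rank [2m].                         *)
Definition torus (b : 'I_(2 * m) -> 'rV[R[i]]_m) : zmodType :=
  Quotient.quot (lattice b).

Definition torus_space b : topologicalType :=
  quotient_topology (Quotient.quot (lattice b)).

Definition torus_proj b (x : 'rV[R[i]]_m) : torus b :=
  \pi_(Quotient.quot (lattice b)) x.

End ComplexTori.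

Section TorusActions.
Context {R : realType} {M : topologicalType} {d : nat}.
Variable atlas : set (@chart R M d).
Context {m : nat} {b : 'I_(2 * m) -> 'rV[R[i]]_m}.
Variable rho : torus b -> M -> M.

(* Effectiveness of the action is the injectivity of [rho]: only the neutral   *)
(* element acts as the identity.                                               *)
Definition torus_in_Aut : Prop :=
  [/\ forall x, biholomorphism atlas (rho x),
      forall x y, rho (x + y) = rho x \o rho y,
      injective rho &
      continuous (fun xp : torus_space b * M => rho xp.1 xp.2)].

(* [X] is the vector field on [M] induced by [xi] in [C^m], the Lie algebra of *)
(* the torus: its value at [p] is the velocity at time 0 of the curve          *)
(* [t |-> rho (exp (t xi)) p].                                                 *)
Definition fundamental_field (xi : 'rV[R[i]]_m)
    (X : @chart R M d -> M -> 'rV[R[i]]_d) : Prop :=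
  vector_field atlas X /\
  forall phi, atlas phi -> forall p, chart_dom phi p ->
    has_velocity
      (fun t : R => chart_map phi (rho (torus_proj b (t%:C *: xi)) p))
      (X phi p).

Definition torus_Lie_algebra : set (@chart R M d -> M -> 'rV[R[i]]_d) :=
  [set X | exists xi, fundamental_field xi X].

(* The first clause says that the action is differentiable, so that the Lie    *)
(* algebra of the torus does act by vector fields; otherwise the second clause *)
(* could hold for lack of fundamental fields.                                  *)
Definition preserved_by_J : Prop :=
  (forall xi, exists X, fundamental_field xi X) /\
  (forall X, torus_Lie_algebra X -> torus_Lie_algebra (J X)).

End TorusActions.

(* Main.v *)
(** Twisting by conjugate exponents, [z_i |-> z_i e^<conj Lambda_i, xi>], is a
    holomorphic action of C^m on [Sset] that commutes with that of C^* x C^m and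
    so descends to N. If [xi] acts trivially on N, comparing moduli at the point
    (1, ..., 1) shows that an affine function is constant on a real affine frame,
    so that the compensating [T] is [conj xi]; comparing arguments, [xi] acts
    trivially iff all [Im <Lambda_i - Lambda_0, conj xi>] lie in pi Z. By (K)
    these real-linear forms have an integral matrix in suitable coordinates, and
    its Smith normal form exhibits the kernel as the preimage of Z^2m under a
    real-linear isomorphism, i.e. as a lattice of rank 2m. Holomorphy is read off
    from the local sections and pull-backs provided by the atlas, and since the
    action is holomorphic in [xi] too, the field of [c xi] is [c] times that of
    [xi]. *)
From HB Require Import structures.
Require Import Defs.
From mathcomp Require Import all_boot all_order all_algebra.
From mathcomp Require Import generic_quotient ring_quotient complex.
From mathcomp Require Import all_classical all_reals all_analysis.
From mathcomp Require Import ring lra.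

Set Implicit Arguments.
Unset Strict Implicit.
Unset Printing Implicit Defensive.

Import Order.TTheory GRing.Theory Num.Theory.
Import numFieldNormedType.Exports.

Local Open Scope classical_set_scope.
Local Open Scope ring_scope.
Local Open Scope complex_scope.
Local Open Scope quotient_scope.

(** * Continuity and differentiability over a numeric field *)

Section NumField.
Context {K : numFieldType}.

Lemma linear_approx_differentiable (f : K -> K) (d : K) :
  (forall e, 0 < e -> exists2 r, 0 < r &
    forall h, `|h| < r -> `|f h - f 0 - d * h| <= e * `|h|) ->
  differentiable f 0.
Proof.
move=> H; apply/derivable1_diffP; apply/cvg_ex; exists d.
apply/cvgrPdist_lt => e e0.
have e2 : 0 < e / 2 by rewrite divr_gt0.
have {H} [r r0 H] := H _ e2.
rewrite near_withinE; apply/nbhs_ballP; exists r => //.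
move=> h; rewrite /ball /= sub0r normrN => hr h0.
rewrite addr0 -[_ *: 1]/(_ * 1) mulr1.
have -> : d - h^-1 *: (f h - f 0) = - (h^-1 * (f h - f 0 - d * h)).
  by rewrite mulrBr [d * h]mulrC mulKf// opprB.
rewrite normrN normrM normfV mulrC ltr_pdivrMr ?normr_gt0//.
apply: (le_lt_trans (H h hr)).
by rewrite ltr_pM2r ?normr_gt0// ltr_pdivrMr// ltr_pMr// ltr1n.
Qed.

Lemma differentiable_scaled_translate (f : K -> K) (c z : K) :
  differentiable f 0 -> differentiable (fun w => c * f (w - z)) z.
Proof.
move=> df; apply: differentiableM; first exact: differentiable_cst.
apply: (@differentiable_comp _ _ _ _ (fun w : K => w - z) f).
  by apply: differentiableB => //; exact: differentiable_cst.
by rewrite subrr.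
Qed.

End NumField.

Section NearDifferential.
Context {K : numFieldType} {V W : normedModType K}.

(** The first-order expansion depends only on the germ. Chart expressions agree with the expected
    compositions only near a point, since charts are arbitrary off their domains. *)
Lemma near_eq_diff (f g : V -> W) (x : V) :
  (\forall y \near x, f y = g y) -> differentiable g x ->
  differentiable f x /\ 'd f x = 'd g x :> (V -> W).
Proof.
move=> fg dg.
have fgx : f x = g x by exact: nbhs_singleton fg.
have fg0 : \forall h \near 0, f (h + x) = g (h + x).
  by move: fg; rewrite (near_shift 0) subr0.
have fE : f \o shift x = cst (f x) + 'd g x +o_ 0 id.
  apply/eqaddoP => e e0.
  have := diff_locally dg => /eqaddoP/(_ e e0) H.
  near=> h.
  have -> : (f \o shift x - (cst (f x) + 'd g x)) h =
            (g \o shift x - (cst (g x) + 'd g x)) h.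
    by rewrite !fctE /= fgx; congr (_ - _); near: h.
  by near: h.
have dfE : 'd f x = 'd g x :> (V -> W).
  by apply: diff_unique => //; exact: diff_continuous.
split=> //; apply/diff_locallyP; rewrite dfE; split=> //.
exact: diff_continuous.
Unshelve. all: by end_near. Qed.

End NearDifferential.

Lemma near_eq_diff_comp {K : numFieldType} {U V W : normedModType K}
    (f : U -> W) (g : U -> V) (h : V -> W) (x v : U) :
  (\forall y \near x, f y = h (g y)) ->
  differentiable g x -> differentiable h (g x) ->
  'd f x v = 'd h (g x) ('d g x v).
Proof.
move=> fhg dg dh.
have dhg : differentiable (h \o g) x by exact: differentiable_comp.
by rewrite (near_eq_diff fhg dhg).2 diff_comp.
Qed.

Lemma continuous_pair {X Y Z : topologicalType} (f : X -> Y) (g : X -> Z) :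
  continuous f -> continuous g -> continuous (fun x => (f x, g x)).
Proof. by move=> fc gc x; apply: cvg_pair; [exact: fc|exact: gc]. Qed.

Lemma translation_continuous {K : numFieldType} {V : normedModType K} (l : V) :
  continuous (fun x : V => x + l).
Proof. by move=> x; exact: (cvgD cvg_id (cvg_cst l)). Qed.

Section RowFunctions.
Context {K : numFieldType}.

Lemma row_continuous_at {T : topologicalType} {n} (f : T -> 'rV[K]_n) (x : T) :
  (forall j, {for x, continuous (fun t => f t ord0 j)}) ->
  {for x, continuous f}.
Proof.
move=> fc A [P Px PA].
have : \forall t \near x, forall j, P ord0 j (f t ord0 j).
  apply: filter_forall => j; exact: fc (Px ord0 j).
by apply: filterS => t Pt; apply: PA => i j; rewrite ord1.
Qed.

Lemma sum_continuous_at {T : topologicalType} {I : finType}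
    (F : I -> T -> K) (x : T) :
  (forall j, {for x, continuous (F j)}) ->
  {for x, continuous (fun t => \sum_j F j t)}.
Proof.
move=> Fc.
have -> : (fun t => \sum_j F j t) = \sum_j F j.
  by apply/funext => t; rewrite fct_sumE.
elim/big_ind: _ => [|f g fc gc|j _]; last exact: Fc.
  exact: cvg_cst.
exact: cvgD.
Qed.

Lemma row_differentiable {V : normedModType K} {n} (f : V -> 'rV[K]_n) (x : V) :
  (forall j, differentiable (fun t => f t ord0 j) x) -> differentiable f x.
Proof.
move=> df.
have -> : f = \sum_j (fun t => f t ord0 j *: delta_mx ord0 j).
  by apply/funext => t; rewrite fct_sumE [LHS]row_sum_delta.
apply: differentiable_sum => j; exact: differentiableZl.
Qed.

Variables (m n : nat) (e : K -> K) (L : 'I_n -> 'rV[K]_m).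

(** For [e := expC] this unfolds to [Cact]; it serves for [Lambda] and for the conjugate exponents
    alike. *)
Definition exp_action (a : K) (T : 'rV[K]_m) (z : 'rV[K]_n) : 'rV[K]_n :=
  \row_i (a * z ord0 i * e (\sum_j L i ord0 j * T ord0 j)).

Lemma exp_action_continuous a : continuous e ->
  continuous (fun Tz : 'rV[K]_m * 'rV[K]_n => exp_action a Tz.1 Tz.2).
Proof.
move=> ec [T z]; apply: row_continuous_at => i.
have -> : (fun t : 'rV[K]_m * 'rV[K]_n => exp_action a t.1 t.2 ord0 i) =
  (fun t => a * t.2 ord0 i * e (\sum_j L i ord0 j * t.1 ord0 j)).
  by apply/funext => t; rewrite mxE.
apply: cvgM.
  apply: cvgM; first exact: cvg_cst.
  apply: (@cvg_comp _ _ _ snd (fun M : 'rV[K]_n => M ord0 i)).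
    exact: cvg_snd.
  exact: coord_continuous.
apply: continuous_cvg; first exact: ec.
apply: sum_continuous_at => j.
apply: cvgM; first exact: cvg_cst.
apply: (@cvg_comp _ _ _ fst (fun M : 'rV[K]_m => M ord0 j)).
  exact: cvg_fst.
exact: coord_continuous.
Qed.

Lemma exp_action_differentiable a T z : differentiable (exp_action a T) z.
Proof.
apply: row_differentiable => i.
have -> : (fun t => exp_action a T t ord0 i) =
  (fun t => a * e (\sum_j L i ord0 j * T ord0 j) * t ord0 i).
  by apply/funext => t; rewrite mxE mulrAC.
apply: differentiableM; [exact: differentiable_cst|exact: differentiable_coord].
Qed.

Lemma exp_action_line_differentiable a xi z : (forall w, differentiable e w) ->
  differentiable (fun w : K => exp_action a (w *: xi) z) 0.
Proof.
move=> de; apply: row_differentiable => i.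
have -> : (fun w : K => exp_action a (w *: xi) z ord0 i) =
  (fun w => a * z ord0 i * e (w * \sum_j L i ord0 j * xi ord0 j)).
  apply/funext => w; rewrite mxE mulr_sumr; congr (_ * e _).
  by apply: eq_bigr => j _; rewrite mxE mulrCA.
apply: differentiableM; first exact: differentiable_cst.
exact: (@differentiable_comp _ _ _ _ (fun w : K => w * _) e).
Qed.

Lemma difference_quotient_cvg {W : normedModType K} (g : K -> W) (c : K) :
  differentiable g 0 ->
  (fun h => h^-1 *: (g (h * c) - g 0)) @ 0^' --> 'd g 0 c.
Proof.
move=> dg; rewrite -deriveE//.
have dv : derivable g 0 c by exact: diff_derivable.
have -> : (fun h => h^-1 *: (g (h * c) - g 0)) =
  (fun h => h^-1 *: ((g \o shift 0) (h *: c) - g 0)).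
  by apply/funext => h /=; rewrite addr0.
exact: dv.
Qed.

End RowFunctions.

(** * The complex exponential *)

Section ComplexExponential.
Context {R : realType}.

Lemma cosD2pi_int (k : int) (x : R) : cos (x + k%:~R * (pi *+ 2)) = cos x.
Proof.
have cosn (l : nat) y : cos (y + l%:R * (pi *+ 2)) = cos y :> R.
  elim: l y => [|l IH] y; first by rewrite mul0r addr0.
  by rewrite -natr1 mulrDl mul1r addrA cosD2pi.
case: k => k; first exact: cosn.
by rewrite NegzE -{2}[x](subrK (k.+1%:R * (pi *+ 2))) cosn rmorphN mulNr.
Qed.

(** The remainder [r] of [x] modulo 2 pi lies in [0, 2 pi[ and has cosine 1, so sin (r / 2) = 0; but
    sin is positive on ]0, pi[. *)
Lemma cos_eq1 (x : R) : cos x = 1 -> exists k : int, x = k%:~R * (pi *+ 2).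
Proof.
move=> cx1; have p0 := pi_gt0 R.
exists (Num.floor (x / (pi *+ 2))); set k := Num.floor _.
have q0 : 0 < pi *+ 2 :> R by rewrite pmulrn_lgt0.
have /andP[k1 k2] := floor_itv (x / (pi *+ 2)).
pose r := x - k%:~R * (pi *+ 2).
have cr : cos r = 1 by rewrite -(cosD2pi_int k) /r subrK.
have r0 : 0 <= r by rewrite /r subr_ge0 -ler_pdivlMr.
have r2 : r < pi *+ 2.
  by rewrite /r ltrBlDr -[X in X + _]mul1r -mulrDl -ltr_pdivrMr// addrC -intrD1.
suff: r = 0 by move/eqP; rewrite subr_eq0 => /eqP.
apply/eqP; move: r0; rewrite le_eqVlt => /predU1P[<-//|r0].
have : 0 < sin (r / 2) by apply: sin_gt0_pi; rewrite divr_gt0//=; lra.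
have : sin (r / 2) = 0; last by move=> ->; rewrite ltxx.
apply/eqP; rewrite -sqrf_eq0 sin2cos2.
have := cos_mulr2n (r / 2); have -> : r / 2 *+ 2 = r by lra.
by rewrite cr => h; apply/eqP; lra.
Qed.

Lemma expC_neq0 (z : R[i]) : expC z != 0.
Proof.
apply/eqP => z0; have := expCD z (- z); rewrite subrr expC0 z0 mul0r => /eqP.
by rewrite oner_eq0.
Qed.

Lemma expCB (z w : R[i]) : expC (z - w) = expC z / expC w.
Proof.
apply: (canRL (mulfK (expC_neq0 w))); by rewrite -expCD subrK.
Qed.

Lemma expC_eq1 (z : R[i]) :
  expC z = 1 <->
  complex.Re z = 0 /\ exists k : int, complex.Im z = k%:~R * (pi *+ 2).
Proof.
split.
  case: z => a b /eqP; rewrite eq_complex /=.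
  rewrite !(mulr0, mul0r, subr0, addr0, add0r) => /andP[/eqP h1 /eqP h2].
  have ea := expR_gt0 a.
  have sb : sin b = 0 by move/eqP: h2; rewrite mulf_eq0 gt_eqF//= => /eqP.
  (* From sin b = 0, cos b is 1 or -1; e^a cos b = 1 with e^a > 0 rules out -1. *)
  have cb : cos b = 1.
    have : (cos b) ^+ 2 = 1 by rewrite cos2sin2 sb expr0n subr0.
    move/eqP; rewrite sqrf_eq1 => /orP[/eqP//|/eqP cb].
    by move: h1; rewrite cb; lra.
  split; last exact: cos_eq1.
  by apply: expR_inj; rewrite expR0 -h1 cb mulr1.
case: z => a b /= [-> [k ->]]; rewrite /expC /= expR0.
have hc := cosD2pi_int k 0; rewrite add0r cos0 in hc.
have hs : sin (k%:~R * (pi *+ 2)) = 0 :> R.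
  by apply/eqP; rewrite -sqrf_eq0 sin2cos2 hc expr1n subrr.
by rewrite hc hs mul1r.
Qed.

Lemma is_derive_littleo (f : R -> R) (d : R) : is_derive (0 : R) (1 : R) f d ->
  forall e, 0 < e -> exists2 r : R, 0 < r &
    forall h, `|h| < r -> `|f h - f 0 - d * h| <= e * `|h|.
Proof.
move=> [df fd] e e0; rewrite /derivable in df.
have /cvgrPdist_lt/(_ _ e0) : h^-1 *: (f (h *: 1 + 0) - f 0) @[h --> 0^'] --> d.
  by rewrite -fd.
rewrite near_withinE => /nbhs_ballP[r /= r0 H]; exists r => // h hr.
have [->|h0] := eqVneq h 0; first by rewrite subrr mulr0 subr0 normr0 mulr0.
have := H h; rewrite /ball /= sub0r normrN => /(_ hr h0).
rewrite addr0 -[h *: 1]/(h * 1) mulr1 => /ltW lee.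
have -> : f h - f 0 - d * h = - ((d - h^-1 *: (f h - f 0)) * h).
  by rewrite mulrBl -[h^-1 *: _]/(h^-1 * _) mulrAC mulVf// mul1r opprB.
by rewrite normrN normrM ler_wpM2r.
Qed.

(** The real and imaginary parts of the error at a + ib are combinations of the first-order errors
    of exp, sin and cos at 0. *)
Lemma expC_linear_approx (e : R) : 0 < e -> exists2 r : R, 0 < r &
  forall z : R[i], `|z| < r%:C -> `|expC z - 1 - z| <= e%:C * `|z|.
Proof.
move=> e0.
(* The factor 8 = 3 + 5 adds the bounds on [u] and [v] below; [e1 <= 1] gives |1 + a| <= 2. *)
have [e1 [e10 e11 e18]] : exists e1 : R, [/\ 0 < e1, e1 <= 1 & e1 * 8 <= e].
  exists (Num.min 1 (e / 8)).
  by rewrite lt_min ltr01 divr_gt0// -ler_pdivlMr// !ge_min !lexx orbT.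
have [r1 r10 H1] := is_derive_littleo (is_derive_expR 0) e10.
have [r2 r20 H2] := is_derive_littleo (is_derive_sin 0) e10.
have [r3 r30 H3] := is_derive_littleo (is_derive_cos 0) e10.
exists (Num.min (Num.min r1 r2) (Num.min r3 e1)).
  by rewrite !lt_min r10 r20 r30 e10.
case=> a b zr.
have [Hre Him] : (`|a|%:C <= `|a +i* b|) /\ (`|b|%:C <= `|a +i* b|).
  by rewrite !normc_def !lecR /= -!sqrtr_sqr !ler_sqrt ?addr_ge0 ?sqr_ge0//;
    rewrite lerDl lerDr !sqr_ge0.
(* The modulus in [R[i]] is a complex number with zero imaginary part; it is replaced by a real [t]
   so that the estimates take place in [R]. *)
set N := `|a +i* b| in zr Hre Him *.
have NE : N = (complex.Re N)%:C by rewrite /N normc_def.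
move: (complex.Re N) NE => t NE; rewrite {N}NE ?lecR ?ltcR in zr Hre Him *.
move: zr; rewrite !lt_min => /andP[/andP[t1 t2] /andP[t3 t4]].
have := H1 a (le_lt_trans Hre t1); have := H2 b (le_lt_trans Him t2).
have := H3 b (le_lt_trans Him t3).
rewrite expR0 sin0 cos0 !oppr0 mul0r !(subr0, addr0, mul1r) => C S E.
have -> : expC (a +i* b) - 1 - (a +i* b) =
  ((expR a - 1 - a) * cos b + (1 + a) * (cos b - 1)) +i*
  ((expR a - 1) * sin b + (sin b - b)).
  by apply/eqP; rewrite eq_complex /=; apply/andP; split; apply/eqP; ring.
have cb : `|cos b| <= 1 := cos_max b.
have a1 : `|1 + a| <= 2.
  by rewrite (le_trans (ler_normD _ _))// normr1; lra.
have ea : `|expR a - 1| <= 2 * `|a|.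
  have -> : expR a - 1 = (expR a - 1 - a) + a by rewrite subrK.
  rewrite (le_trans (ler_normD _ _))//.
  by have := ler_wpM2r (normr_ge0 a) e11; lra.
have sb : `|sin b| <= 2 * e1.
  have -> : sin b = (sin b - b) + b by rewrite subrK.
  rewrite (le_trans (ler_normD _ _))//.
  by have := ler_wpM2r (normr_ge0 b) e11; lra.
set u := _ + _ * _; set v := _ + (_ - _).
have uE : `|u| <= e1 * t * 3.
  rewrite /u (le_trans (ler_normD _ _))// !normrM.
  have := ler_pM (normr_ge0 _) (normr_ge0 _) E cb.
  have := ler_pM (normr_ge0 _) (normr_ge0 _) a1 C.
  have := ler_wpM2l (ltW e10) Hre; have := ler_wpM2l (ltW e10) Him.
  by lra.
have vE : `|v| <= e1 * t * 5.
  rewrite /v (le_trans (ler_normD _ _))// !normrM.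
  have := ler_pM (normr_ge0 _) (normr_ge0 _) ea sb.
  have := ler_wpM2l (ltW e10) Hre; have := ler_wpM2l (ltW e10) Him.
  by lra.
rewrite -rmorphM.
apply: (@le_trans _ _ (`|u|%:C + `|v|%:C)).
  have -> : u +i* v = u%:C + 'i%C * v%:C by rewrite [LHS]complexE.
  rewrite (le_trans (ler_normD _ _))// normrM !normc_def /= !expr0n /=.
  by rewrite !(addr0, add0r) expr1n sqrtr1 mul1r !sqrtr_sqr.
rewrite -rmorphD lecR (le_trans (lerD uE vE))//.
have t0 : 0 <= t by rewrite (le_trans _ Hre).
by have := ler_wpM2r t0 e18; lra.
Qed.

(** At 0 this is the linear estimate; elsewhere e^w = e^z e^(w - z). *)
Lemma differentiable_expC (z : R[i]) : differentiable (expC : R[i] -> R[i]) z.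
Proof.
have d0 : differentiable (expC : R[i] -> R[i]) 0.
  apply: (@linear_approx_differentiable R[i] expC 1) => e e0.
  (* A positive element for the order of [R[i]] is real. *)
  have [e' e'0 ->] : exists2 e', 0 < e' & e = e'%:C.
    by case: e e0 => a b; rewrite ltcE /= => /andP[/eqP -> ?]; exists a.
  have [r r0 H] := expC_linear_approx e'0; exists r%:C; first by rewrite ltcR.
  by move=> h /H; rewrite expC0 mul1r.
have -> : expC = (fun w : R[i] => expC z * expC (w - z)) :> (R[i] -> R[i]).
  by apply/funext => w; rewrite -expCD addrC subrK.
exact: (@differentiable_scaled_translate R[i]).
Qed.

Lemma continuous_expC : continuous (expC : R[i] -> R[i]).
Proof.
by move=> z; apply: differentiable_continuous; exact: differentiable_expC.
Qed.

End ComplexExponential.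

(** * Real linear algebra on C^m *)

Section RealCoordinates.
Context {R : realType} {m : nat}.
Local Notation V := 'rV[R[i]]_m.

Definition conjv (x : V) : V := map_mx (@conjc R) x.

Definition dot (x y : V) : R[i] := \sum_j x ord0 j * y ord0 j.

Lemma conjvK : involutive conjv.
Proof. by move=> x; apply/rowP => j; rewrite !mxE conjcK. Qed.

Lemma dotZDl (c : R[i]) x y z : dot (c *: x + y) z = c * dot x z + dot y z.
Proof.
rewrite /dot mulr_sumr -big_split; apply: eq_bigr => j _.
by rewrite !mxE mulrDl mulrA.
Qed.

Lemma dotC x y : dot x y = dot y x.
Proof. by apply: eq_bigr => j _; rewrite mulrC. Qed.

Lemma dotBl x y z : dot (x - y) z = dot x z - dot y z.
Proof. by rewrite [x - y]addrC -scaleN1r dotZDl mulN1r addrC. Qed.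

Lemma dot_sum I (s : seq I) (P : pred I) (c : I -> R[i]) (F : I -> V) y :
  dot (\sum_(i <- s | P i) c i *: F i) y =
  \sum_(i <- s | P i) c i * dot (F i) y.
Proof.
elim/big_ind2: _ => [|x a z b ha hb|i _].
- by rewrite /dot big1// => j _; rewrite mxE mul0r.
- by rewrite -[a]scale1r dotZDl mul1r ha hb.
- rewrite -[_ *: _]addr0 dotZDl [dot 0 y]big1 ?addr0// => j _.
  by rewrite mxE mul0r.
Qed.

(** Conjugation passes from the exponents to the parameter, which is where the compensating
    [conj xi] comes from. *)
Lemma dot_conj x y : dot (conjv x) y = conjc (dot x (conjv y)).
Proof.
rewrite /dot rmorph_sum; apply: eq_bigr => j _.
by rewrite !mxE rmorphM /= conjcK.
Qed.

Lemma Re_mulrC (r : R) (z : R[i]) : complex.Re (r%:C * z) = r * complex.Re z.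
Proof. by case: z => a b /=; rewrite mul0r subr0. Qed.

Lemma Im_mulrC (r : R) (z : R[i]) : complex.Im (r%:C * z) = r * complex.Im z.
Proof. by case: z => a b /=; rewrite mul0r addr0. Qed.

Lemma ReD (z w : R[i]) : complex.Re (z + w) = complex.Re z + complex.Re w.
Proof. by case: z; case: w. Qed.

Lemma ImD (z w : R[i]) : complex.Im (z + w) = complex.Im z + complex.Im w.
Proof. by case: z; case: w. Qed.

Lemma ImN (z : R[i]) : complex.Im (- z) = - complex.Im z.
Proof. by case: z. Qed.

Lemma ReN (z : R[i]) : complex.Re (- z) = - complex.Re z.
Proof. by case: z. Qed.

(** Testing on x = conj w gives the sum of the |w_j|^2. *)
Lemma Re_dot_eq0 (w : V) : (forall x, complex.Re (dot x w) = 0) -> w = 0.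
Proof.
move=> /(_ (conjv w)); rewrite /dot.
have -> : complex.Re (\sum_j conjv w ord0 j * w ord0 j) =
   \sum_j complex.Re (conjv w ord0 j * w ord0 j).
  by apply: (big_morph _ ReD).
have nn (z : R[i]) :
    complex.Re (conjc z * z) = complex.Re z ^+ 2 + complex.Im z ^+ 2.
  by case: z => a b /=; ring.
move/eqP; rewrite psumr_eq0 => [/allP w0|j _]; last first.
  by rewrite mxE nn addr_ge0 ?sqr_ge0.
apply/rowP => j; rewrite mxE; apply/eqP; have := w0 j (mem_index_enum _).
rewrite mxE nn paddr_eq0 ?sqr_ge0// !sqrf_eq0 => /=.
by rewrite eq_complex.
Qed.

(** Every point is a real affine combination of the frame, so Re <x, w> equals [r] everywhere; x = 0
    gives r = 0, and the form vanishes. *)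
Lemma real_affine_frame_eq0 n (Lambda : 'I_n -> V) (sigma : {set 'I_n})
    (w : V) (r : R) :
  real_affine_frame Lambda sigma ->
  (forall i, i \in sigma -> complex.Re (dot (Lambda i) w) = r) -> w = 0.
Proof.
move=> [_ span] wr.
have all_r x : complex.Re (dot x w) = r.
  have [c [c1 ->]] := span x; rewrite dot_sum.
  rewrite (big_morph _ ReD (erefl : complex.Re (0 : R[i]) = 0)).
  rewrite -[RHS]mul1r -c1 mulr_suml; apply: eq_bigr => i /wr <-.
  exact: Re_mulrC.
apply: Re_dot_eq0 => x; rewrite all_r -(all_r 0).
by rewrite /dot big1// => j _; rewrite mxE mul0r.
Qed.

(** The real parts followed by the imaginary parts; passing through a 2 x m matrix yields the index
    type ['I_(2 * m)] of lattice bases. *)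
Definition real_coord (x : V) : 'rV[R]_(2 * m) :=
  mxvec (\matrix_(e < 2, j < m)
    if e == ord0 then complex.Re (x ord0 j) else complex.Im (x ord0 j)).

Definition of_real_coord (v : 'rV[R]_(2 * m)) : V :=
  \row_j (vec_mx v ord0 j +i* vec_mx v ord_max j).

Lemma real_coordK : cancel real_coord of_real_coord.
Proof.
by move=> x; apply/rowP => j; rewrite mxE mxvecK !mxE /=; case: (x ord0 j).
Qed.

Lemma of_real_coordK : cancel of_real_coord real_coord.
Proof.
move=> v; apply/rowP => k; case/mxvec_indexP: k => e j; rewrite mxvecE !mxE /=.
case: ifPn => [/eqP -> //|e0]; suff -> : e = ord_max by [].
by case: e e0 => [[|[|]]//= *]; exact: val_inj.
Qed.

Lemma real_coordZD (r : R) x y :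
  real_coord (r%:C *: x + y) = r *: real_coord x + real_coord y.
Proof.
rewrite /real_coord -linearZ -linearD; congr mxvec.
apply/matrixP => e j; rewrite !mxE; case: ifP => _.
  by rewrite ReD Re_mulrC.
by rewrite ImD Im_mulrC.
Qed.

Lemma of_real_coordZD (r : R) v w :
  of_real_coord (r *: v + w) = r%:C *: of_real_coord v + of_real_coord w.
Proof.
apply/rowP => j; rewrite !mxE.
by apply/eqP; rewrite eq_complex /= !mul0r subr0 addr0 !eqxx.
Qed.

End RealCoordinates.

(** In finite dimension, an injective endomorphism has an invertible matrix. *)
Lemma row_linear_inj_surj (F : fieldType) k (f : 'rV[F]_k -> 'rV[F]_k) :
  (forall r x y, f (r *: x + y) = r *: f x + f y) ->
  (forall x, f x = 0 -> x = 0) -> forall y, exists x, f x = y.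
Proof.
move=> flin f0 y.
pose lf := GRing.isLinear.Build _ _ _ _ f flin.
pose F' : {linear 'rV[F]_k -> 'rV[F]_k} := HB.pack f lf.
have fE x : f x = x *m lin1_mx F' by rewrite mul_rV_lin1.
have fr : row_free (lin1_mx F').
  by apply: inj_row_free => v; rewrite -fE; exact: f0.
exists (y *m pinvmx (lin1_mx F')).
by rewrite fE mulmxKpV// submx_full// row_full_unit -row_free_unit.
Qed.

Lemma linear_coordE (F : fieldType) k (f : 'rV[F]_k -> F) :
  (forall r x y, f (r *: x + y) = r * f x + f y) ->
  forall x, f x = \sum_j x ord0 j * f (delta_mx ord0 j).
Proof.
move=> flin x.
have f0 : f 0 = 0.
  by have := flin (-1) 0 0; rewrite scaler0 addr0 mulN1r addNr.
have fD : {morph f : u v / u + v >-> u + v}.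
  by move=> u v; rewrite -{1}[u]scale1r flin mul1r.
rewrite {1}[x]row_sum_delta (big_morph f fD f0).
apply: eq_bigr => j _.
by rewrite -[_ *: _]addr0 flin f0 addr0.
Qed.

(** * The kernel of the action *)

Section Lattice.
Context {R : realType} {m n : nat}.
Local Notation V := 'rV[R[i]]_m.
Variables (eps : {set {set 'I_n}}) (Lambda : 'I_n -> V) (i0 : 'I_n).
Hypothesis hst : studyable eps Lambda.

Definition conj_Lambda (i : 'I_n) : V := conjv (Lambda i).

(** Triviality at the class of (1, ..., 1), which implies triviality on N. *)
Definition acts_trivially (xi : V) : Prop :=
  exists a T, a != 0 /\
    forall i, expC (pairing conj_Lambda i xi) = a * expC (pairing Lambda i T).

Lemma Re_dot_const_eq0 (w : V) :
  (forall i, complex.Re (dot (Lambda i) w) = complex.Re (dot (Lambda i0) w)) ->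
  w = 0.
Proof.
case: hst => -[/set0Pn[s se] _] fr wc.
exact: (real_affine_frame_eq0 (fr s se) (fun i _ => wc i)).
Qed.

(** The division by pi turns triviality into integrality: conj z - z = -2 i Im z, whose exponential
    is 1 exactly when Im z / pi is an integer. *)
Definition im_pairing (u xi : V) : R := complex.Im (dot u (conjv xi)) / pi.

Lemma im_pairingZDl (r : R) u v xi :
  im_pairing (r%:C *: u + v) xi = r * im_pairing u xi + im_pairing v xi.
Proof. by rewrite /im_pairing dotZDl ImD Im_mulrC mulrDl mulrA. Qed.

Lemma im_pairingZDr (r : R) u xi eta :
  im_pairing u (r%:C *: xi + eta) = r * im_pairing u xi + im_pairing u eta.
Proof.
rewrite /im_pairing.
have -> : conjv (r%:C *: xi + eta) = r%:C *: conjv xi + conjv eta.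
  apply/rowP => j; rewrite !mxE rmorphD rmorphM; congr (_ * _ + _).
  exact: conjc_real.
by rewrite dotC dotZDl ImD Im_mulrC mulrDl mulrA ![dot _ u]dotC.
Qed.

Lemma acts_triviallyP (xi : V) :
  acts_trivially xi <->
  forall i, im_pairing (Lambda i - Lambda i0) xi \is a Num.int.
Proof.
have p0 := pi_gt0 R.
pose u i := dot (Lambda i) (conjv xi).
have uE i : pairing conj_Lambda i xi = conjc (u i) by exact: dot_conj.
have im_conj (z : R[i]) : complex.Im (conjc z - z) = - complex.Im z *+ 2.
  by case: z => a b /=; rewrite mulr2n.
have re_conj (z : R[i]) : complex.Re (conjc z - z) = 0.
  by case: z => a b /=; rewrite subrr.
split=> [[a [T [a0 H]]] i|H].
  (* Subtracting the value at [i0] eliminates the factor [a]. *)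
  pose d i := pairing conj_Lambda i xi - pairing Lambda i T.
  have dE j : expC (d j - d i0) = 1.
    by rewrite expCB !expCB !H !mulfK ?expC_neq0// divff.
  (* Real parts: Re <Lambda_j, conj xi - T> does not depend on j. *)
  have TE : conjv xi - T = 0.
    apply: Re_dot_const_eq0 => j; apply/eqP; rewrite -subr_eq0 -ReN -ReD.
    have /expC_eq1[h _] := dE j; rewrite -h /d !uE.
    rewrite ![dot _ (_ - _)]dotC !dotBl ![dot _ (Lambda _)]dotC.
    rewrite -/(u _) -/(u i0) !(ReD, ReN).
    have reC (z : R[i]) : complex.Re (conjc z) = complex.Re z by case: z.
    by rewrite !reC.
  have {}TE : T = conjv xi by apply/esym/eqP; rewrite -subr_eq0 TE.
  have /expC_eq1[_ [k hk]] := dE i.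
  rewrite /im_pairing dotBl -/(u i) -/(u i0) ImD ImN.
  suff -> : (complex.Im (u i) - complex.Im (u i0)) / pi = (- k)%:~R.
    exact: intr_int.
  apply: (canLR (mulfK (lt0r_neq0 p0))); rewrite rmorphN.
  have dE' j : d j = conjc (u j) - u j by rewrite /d uE TE.
  by move: hk; rewrite !dE' ImD ImN !im_conj; lra.
(* With T = conj xi, the factor e^(conj u_i - u_i) must not depend on i; its value at [i0] is the
   witness. *)
exists (expC (conjc (u i0) - u i0)), (conjv xi); split; first exact: expC_neq0.
move=> i; rewrite uE -[pairing _ _ _]/(u i) -expCD; have /intrP[k hk] := H i.
have {}hk : complex.Im (u i) - complex.Im (u i0) = k%:~R * pi.
  move: hk; rewrite /im_pairing dotBl ImD ImN.
  by move=> /(canRL (mulfVK (lt0r_neq0 p0))).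
have -> : conjc (u i) = (conjc (u i) - u i - (conjc (u i0) - u i0)) +
  (conjc (u i0) - u i0 + u i) by ring.
rewrite expCD.
suff -> : expC (conjc (u i) - u i - (conjc (u i0) - u i0)) = 1.
  by rewrite mul1r.
apply/expC_eq1; rewrite !(ReD (_ - _)) !(ImD (_ - _)) ReN ImN.
rewrite !re_conj !im_conj subrr.
by split=> //; exists (- k); rewrite rmorphN; lra.
Qed.

(** The n forms of [acts_triviallyP] have joint rank 2m; the Smith normal form replaces their n
    integrality conditions by 2m independent ones with the same solutions. *)
Lemma trivial_action_coord : condition_K Lambda -> (2 * m <= n)%N ->
  exists C : V -> 'rV[R]_(2 * m),
    [/\ forall (r : R) x y, C (r%:C *: x + y) = r *: C x + C y,
        forall x, C x = 0 -> x = 0 &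
        forall x, acts_trivially x <-> forall j, C x ord0 j \is a Num.int].
Proof.
move=> [Phi [[PhiL [Psi PhiK PsiK]] Phi_int]] mn.
have PsiL (r : R) x y : Psi (r%:C *: x + y) = r%:C *: Psi x + Psi y.
  by apply: (can_inj PhiK); rewrite PsiK PhiL !PsiK.
(* [P] sends real coordinates to vectors through the inverse of [Phi]; in these coordinates the
   Lambda_i - Lambda_0 are integral by (K). *)
pose P v := Psi (of_real_coord v).
have PL (r : R) x y : P (r *: x + y) = r%:C *: P x + P y.
  by rewrite /P of_real_coordZD PsiL.
pose B xi : 'cV[R]_(2 * m) := \col_k im_pairing (P (delta_mx ord0 k)) xi.
have BL (r : R) x y : B (r%:C *: x + y) = r *: B x + B y.
  by apply/colP => k; rewrite !mxE im_pairingZDr.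
have im_pairingE u xi :
    im_pairing u xi = (real_coord (Phi u) *m B xi) ord0 ord0.
  rewrite -{1}[u]PhiK -{1}[Phi u]real_coordK -/(P _).
  rewrite (linear_coordE (f := fun v => im_pairing (P v) xi)); last first.
    by move=> r x y; rewrite PL im_pairingZDl.
  by rewrite mxE; apply: eq_bigr => k _; rewrite mxE.
pose Ar i := real_coord (Phi (Lambda i - Lambda i0)).
have Ar_int i k : Ar i ord0 k \is a Num.int.
  rewrite /Ar; have -> : Lambda i - Lambda i0 = (-1)%:C *: Lambda i0 + Lambda i.
    by rewrite rmorphN1 scaleN1r addrC.
  rewrite PhiL real_coordZD.
  have rc_int j : real_coord (Phi (Lambda j)) ord0 k \is a Num.int.
    case/mxvec_indexP: k => e l; rewrite mxvecE mxE.
    by have [a [b ->]] := Phi_int j l; case: ifP => _; exact: intr_int.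
  by rewrite !mxE rpredD ?rpredM ?rpredN1 ?rc_int.
pose A : 'M[int]_(n, 2 * m) := \matrix_(i, k) Num.floor (Ar i ord0 k).
have AE i k : (A i k)%:~R = Ar i ord0 k by rewrite mxE floorK.
have [U Uu [W Wu [d _ AD]]] := int_Smith_normal_form A.
set D := \matrix_(i, j) _ in AD.
(* [A = U D W] with [U] invertible over Z: the forms [Theta xi = A B xi] take
   integral values iff [Y xi = D W B xi] is integral, and only the first [2m]
   entries of [Y xi] can be nonzero. *)
pose f_int p q (M : 'M[int]_(p, q)) : 'M[R]_(p, q) := map_mx intr M.
pose Y xi : 'cV[R]_n := f_int _ _ D *m f_int _ _ W *m B xi.
pose Theta xi : 'cV[R]_n := \col_i im_pairing (Lambda i - Lambda i0) xi.
have ThetaE xi : Theta xi = f_int _ _ U *m Y xi.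
  rewrite /Y !mulmxA -!map_mxM -AD; apply/colP => i.
  rewrite !mxE im_pairingE !mxE.
  by apply: eq_bigr => k _; rewrite -/(Ar i) -AE !mxE.
have YE xi : Y xi = f_int _ _ (invmx U) *m Theta xi.
  by rewrite ThetaE mulmxA -map_mxM mulVmx// map_mx1 mul1mx.
have int_mul p q (M : 'M[int]_(p, q)) (v : 'cV[R]_q) :
    (forall i, v i ord0 \is a Num.int) ->
    forall i, (f_int _ _ M *m v) i ord0 \is a Num.int.
  move=> vi i; rewrite mxE rpred_sum// => j _.
  by rewrite rpredM ?mxE ?intr_int.
(* [D] is diagonal of size n by 2m, so its rows from index 2m on vanish. *)
have Y0 xi (i : 'I_n) : (2 * m <= i)%N -> Y xi i ord0 = 0.
  move=> mi; rewrite /Y -mulmxA mxE big1// => j _; rewrite !mxE.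
  by rewrite gtn_eqF ?mulr0n ?mul0r// (leq_trans (ltn_ord j)).
exists (fun xi => \row_j Y xi (widen_ord mn j) ord0); split.
- by move=> r x y; apply/rowP => j; rewrite mxE /Y BL mulmxDr -scalemxAr !mxE.
- move=> x /rowP x0.
  have Yx : Y x = 0.
    apply/colP => i; rewrite [RHS]mxE; have [im|/Y0//] := ltnP i (2 * m).
    have := x0 (Ordinal im); rewrite mxE [RHS]mxE => <-.
    by congr (Y x _ _); exact: val_inj.
  have : Theta x = 0 by rewrite ThetaE Yx mulmx0.
  (* All Im <Lambda_i - Lambda_0, conj x> vanish; multiplying by i turns imaginary parts into real
     ones up to sign, so the frame argument applies to i conj x. *)
  move=> /colP T0; suff: 'i%C *: conjv x = 0 :> V.
    move/eqP; rewrite scaler_eq0 => /orP[/eqP[]/eqP|/eqP x'0].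
      by rewrite oner_eq0.
    apply: (can_inj conjvK); rewrite x'0.
    by apply/rowP => j; rewrite !mxE conjc0.
  apply: Re_dot_const_eq0 => i.
  have ReI (z : R[i]) : complex.Re ('i%C * z) = - complex.Im z.
    by case: z => a b /=; ring.
  have dotI u : dot u ('i%C *: conjv x) = 'i%C * dot u (conjv x).
    by rewrite dotC -[_ *: _]addr0 dotZDl [dot 0 u]big1 ?addr0 1?dotC// => j _;
      rewrite mxE mul0r.
  rewrite !dotI !ReI; congr (- _); apply/eqP.
  rewrite -subr_eq0 -ImN -ImD -dotBl.
  have := T0 i; rewrite !mxE /im_pairing => /eqP.
  by rewrite mulf_eq0 invr_eq0 [pi == 0]gt_eqF ?pi_gt0// orbF.
- move=> x; split.
    move=> /acts_triviallyP H j; rewrite mxE YE; apply: int_mul => i.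
    by rewrite mxE.
  move=> H; apply/acts_triviallyP => i.
  suff: Theta x i ord0 \is a Num.int by rewrite mxE.
  rewrite ThetaE; apply: int_mul => {}i.
  have [im|/Y0->] := ltnP i (2 * m); last by rewrite rpred0.
  have := H (Ordinal im); rewrite mxE; congr (Y x _ _ \is a _); exact: val_inj.
Qed.

(** The basis is the preimage under [C] of the standard basis of R^2m; [C] is onto, being injective
    between real spaces of equal dimension. *)
Lemma trivial_action_lattice : condition_K Lambda -> (2 * m <= n)%N ->
  exists b : 'I_(2 * m) -> V,
    real_free b /\ forall x, x \in lattice b <-> acts_trivially x.
Proof.
move=> hK mn; have [C [CL C0 CP]] := trivial_action_coord hK mn.
have Cinj x y : C x = C y -> x = y.
  move=> Cxy; apply/eqP; rewrite -subr_eq0; apply/eqP/C0.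
  have -> : x - y = (-1)%:C *: y + x by rewrite rmorphN1 scaleN1r addrC.
  by rewrite CL Cxy scaleN1r addNr.
have Csurj v : exists x, C x = v.
  have [w wv] : exists w, C (of_real_coord w) = v.
    apply: row_linear_inj_surj => [r x y|x /C0 x0].
      by rewrite of_real_coordZD CL.
    rewrite -[x]of_real_coordK x0 -[RHS]of_real_coordK; congr real_coord.
    by apply/rowP => j; rewrite !mxE.
  by exists (of_real_coord w).
(* The default 0 of [xget] is never taken, since [C] is onto. *)
pose b j := xget 0 [set x | C x = delta_mx ord0 j].
have bE j : C (b j) = delta_mx ord0 j.
  rewrite /b; case: xgetP => // Nx.
  by have [x] := Csurj (delta_mx ord0 j); move/Nx.
have C00 : C 0 = 0 by have := CL (-1) 0 0; rewrite scaler0 addr0 scaleN1r addNr.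
have CD : {morph C : x y / x + y}.
  move=> x y.
  by rewrite -{1}[x]scale1r -(rmorph1 (real_complex R)) CL scale1r.
have Csum (c : 'I_(2 * m) -> R) : C (\sum_j (c j)%:C *: b j) = \row_j c j.
  rewrite (big_morph C CD C00) [RHS]row_sum_delta; apply: eq_bigr => j _.
  by rewrite -[_ *: b j]addr0 CL C00 addr0 bE mxE.
exists b; split.
  move=> c cb j; have := Csum c; rewrite cb C00 => /rowP/(_ j).
  by rewrite !mxE.
have latE (k : 'I_(2 * m) -> int) :
    \sum_j b j *~ k j = \sum_j ((k j)%:~R : R)%:C *: b j.
  by apply: eq_bigr => j _; rewrite rmorph_int scaler_int.
move=> x; rewrite CP; split.
  move=> /asboolP[k ->] j; rewrite latE Csum mxE; exact: intr_int.
move=> H; apply/asboolP; exists (fun j => Num.floor (C x ord0 j)).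
rewrite latE; apply: Cinj; rewrite Csum; apply/rowP => j.
by rewrite mxE floorK.
Qed.

End Lattice.

(** * The quotient maps *)

Section TorusProjection.
Context {R : realType} {m : nat} (b : 'I_(2 * m) -> 'rV[R[i]]_m).
Local Notation V := 'rV[R[i]]_m.

Lemma torus_projP (x y : V) :
  reflect (torus_proj b x = torus_proj b y) (x - y \in lattice b).
Proof. by rewrite Quotient.idealrBE; exact: eqP. Qed.

Lemma torus_proj_repr (x : torus b) : exists xi, x = torus_proj b xi.
Proof. by exists (repr x); rewrite /torus_proj reprK. Qed.

Lemma torus_projD : {morph torus_proj b : x y / x + y}.
Proof. exact: Quotient.pi_add. Qed.

Lemma torus_proj0 : torus_proj b 0 = 0.
Proof. by apply: (addIr (torus_proj b 0)); rewrite -torus_projD !add0r. Qed.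

Lemma torus_proj_continuous :
  continuous (torus_proj b : V -> torus_space b).
Proof. exact: pi_continuous. Qed.

(** The saturation of [U] is the union of its translates by the lattice. *)
Lemma torus_proj_open (U : set V) : open U ->
  open (torus_proj b @` U : set (torus_space b)).
Proof.
move=> oU; rewrite /open /= /quotient_open.
have -> : \pi_(torus_space b) @^-1` (torus_proj b @` U) =
  \bigcup_(l in [set l | l \in lattice b]) ((fun x => x + l) @^-1` U).
  apply/seteqP; split=> [x [y Uy yx]|x [l /= ll Uxl]] /=.
    exists (y - x); last by rewrite /= addrC subrK.
    by apply/torus_projP.
  by exists (x + l) => //; apply/torus_projP; rewrite addrAC subrr add0r.
apply: bigcup_open => l _.
by have /continuousP := @translation_continuous _ V l; exact.
Qed.

End TorusProjection.

Section Quotient.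
Context {R : realType} {m n : nat}.
Local Notation V := 'rV[R[i]]_m.
Variables (eps : {set {set 'I_n}}) (Lambda : 'I_n -> V).
Local Notation N := (LVMB eps Lambda).
Local Notation pr := (@LVMB_proj R m n eps Lambda).
Local Notation S := (set_type (Sset eps : set 'rV[R[i]]_n)).

Lemma LVMB_projP (z w : S) :
  pr z = pr w <->
  exists a T, a != 0 /\ set_val w = Cact Lambda a T (set_val z).
Proof.
split; first by move/eqmodP => /asboolP.
by move=> H; apply/eqmodP/asboolP.
Qed.

Lemma LVMB_proj_surj (p : N) : exists z, pr z = p.
Proof. by exists (repr p); rewrite /LVMB_proj reprK. Qed.

(** Exponentials never vanish, so the set of nonzero coordinates is unchanged; [L] is arbitrary in
    order to cover the conjugate exponents. *)
Lemma Sset_Cact (L : 'I_n -> V) a T z :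
  a != 0 -> Sset eps z -> Sset eps (Cact L a T z).
Proof.
move=> a0; rewrite /Sset /=; congr (acceptable _ _ : Prop).
apply/setP => i; rewrite !inE mxE mulf_eq0 (negbTE (expC_neq0 _)) orbF.
by rewrite mulf_eq0 (negbTE a0).
Qed.

Definition torus_act_cover (xi : V) (z : S) : S :=
  SigSub
    (mem_set (Sset_Cact (conj_Lambda Lambda) xi (oner_neq0 _) (set_valP z))).

Lemma torus_act_coverE xi z :
  set_val (torus_act_cover xi z) = Cact (conj_Lambda Lambda) 1 xi (set_val z).
Proof. by []. Qed.

Lemma Cact_continuous (L : 'I_n -> V) a T : continuous (Cact L a T).
Proof.
move=> z; apply: differentiable_continuous.
exact: (@exp_action_differentiable R[i] m n expC L a T z).
Qed.

(** The saturation of [W] is the union of its preimages under the elements of C^* x C^m, which act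
    continuously. *)
Lemma LVMB_proj_open (W : set 'rV[R[i]]_n) : open W ->
  open (pr @` (set_val @^-1` W)).
Proof.
move=> oW; rewrite /open /= /quotient_open.
have -> : \pi_N @^-1` (pr @` (set_val @^-1` W)) =
  \bigcup_(aT in [set aT : R[i] * V | aT.1 != 0])
    set_val @^-1` (Cact Lambda aT.1 aT.2 @^-1` W).
  apply/seteqP; split=> [z [w Ww] wz|z [[a T] /= a0 Wz]] /=.
    have /LVMB_projP[a [T [a0 E]]] : pr z = pr w by [].
    by exists (a, T) => //=; rewrite -E.
  exists (SigSub (mem_set (Sset_Cact Lambda T a0 (set_valP z)))) => //.
  by apply/esym/LVMB_projP; exists a, T.
apply: bigcup_open => -[a T] _ /=.
exists (Cact Lambda a T @^-1` W) => //.
by have /continuousP := @Cact_continuous Lambda a T; exact.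
Qed.

(** The topology of [Sset] is induced from C^n, so the pull-back of [U] is the trace of an open
    [W]. *)
Lemma LVMB_open_preimage (U : set N) : open U ->
  exists2 W : set 'rV[R[i]]_n,
    open W & forall z : S, W (set_val z) <-> U (pr z).
Proof.
move=> [W oW WE]; exists W => // z.
by split=> [Wz|Uz]; [have : (set_val @^-1` W) z by []; rewrite WE|
  have : (\pi_N @^-1` U) z by []; rewrite -WE].
Qed.

End Quotient.

(** * The torus action *)

Section TorusAction.
Context {R : realType} {m n : nat}.
Local Notation V := 'rV[R[i]]_m.
Variables (eps : {set {set 'I_n}}) (Lambda : 'I_n -> V).
Local Notation N := (LVMB eps Lambda).
Local Notation pr := (@LVMB_proj R m n eps Lambda).
Local Notation S := (set_type (Sset eps : set 'rV[R[i]]_n)).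
Variable b : 'I_(2 * m) -> V.
Hypothesis latticeP : forall x, x \in lattice b <-> acts_trivially Lambda x.

Definition torus_act (x : torus b) (p : N) : N :=
  pr (torus_act_cover Lambda (repr x) (repr p)).

(** Independence of representatives: changing that of the point costs a pair [(c, U)], which
    commutes with the twist, and changing that of the torus element costs a kernel element, absorbed
    by [(a, T)]; the two pairs compose. *)
Lemma torus_actE xi z :
  torus_act (torus_proj b xi) (pr z) = pr (torus_act_cover Lambda xi z).
Proof.
rewrite /torus_act; set xi' := repr _; set z' := repr _; apply/LVMB_projP.
have /LVMB_projP[c [U [c0 zE]]] : pr z' = pr z by rewrite /LVMB_proj reprK.
have : xi - xi' \in lattice b.
  by apply/torus_projP; rewrite {2}/torus_proj /xi' reprK.
move=> /latticeP[a [T [a0 H]]].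
exists (c * a), (U + T); split; first by rewrite mulf_neq0.
rewrite !torus_act_coverE zE; apply/rowP => i; rewrite !mxE.
have -> : pairing (conj_Lambda Lambda) i xi =
    pairing (conj_Lambda Lambda) i (xi - xi') +
    pairing (conj_Lambda Lambda) i xi' by rewrite -pairingD subrK.
by rewrite expCD H pairingD expCD; ring.
Qed.

Lemma torus_act_coverD xi eta (z : S) :
  torus_act_cover Lambda (xi + eta) z =
  torus_act_cover Lambda xi (torus_act_cover Lambda eta z).
Proof.
apply: val_inj; have := Cact_comp (conj_Lambda Lambda) 1 1 xi eta (set_val z).
by rewrite mul1r => /esym.
Qed.

Lemma torus_actD x y : torus_act (x + y) = torus_act x \o torus_act y.
Proof.
apply/funext => p /=; have [z <-] := LVMB_proj_surj p.
have [[xi ->] [eta ->]] := (torus_proj_repr x, torus_proj_repr y).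
by rewrite -torus_projD !torus_actE torus_act_coverD.
Qed.

Lemma torus_act0 : torus_act 0 = id.
Proof.
apply/funext => p /=; have [z <-] := LVMB_proj_surj p.
rewrite -torus_proj0 torus_actE; congr pr; apply: val_inj.
exact: (Cact1 (conj_Lambda Lambda) (set_val z)).
Qed.

(** At the class of (1, ..., 1), whose support is the whole index set, equality of the twists by
    [xi] and [eta] says precisely that [xi - eta] acts trivially. *)
Lemma torus_act_inj : eps != finset.set0 -> injective torus_act.
Proof.
move=> /set0Pn[s se] x y.
have [[xi ->] [eta ->]] := (torus_proj_repr x, torus_proj_repr y).
have S1 : Sset eps (const_mx 1 : 'rV[R[i]]_n).
  apply/exists_inP; exists s => //; apply/fintype.subsetP => i _.
  by rewrite inE mxE oner_neq0.
pose z : S := SigSub (mem_set S1).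
move=> /(congr1 (fun f => f (pr z))); rewrite !torus_actE.
move=> /esym/LVMB_projP[a [T [a0 E]]].
apply/torus_projP/latticeP; exists a, T; split => // i.
have zE : set_val z = const_mx 1 by [].
move: E; rewrite !torus_act_coverE zE => /rowP/(_ i); rewrite !mxE !mul1r => E.
have : expC (pairing (conj_Lambda Lambda) i (xi - eta)) *
         expC (pairing (conj_Lambda Lambda) i eta) =
       a * expC (pairing Lambda i T) * expC (pairing (conj_Lambda Lambda) i eta).
  by rewrite -expCD -pairingD subrK E mulrAC.
exact: (mulIf (expC_neq0 _)).
Qed.

(** Both projections are open, so the neighbourhoods given by joint continuity upstairs push forward
    to neighbourhoods downstairs. *)
Lemma torus_act_continuous :
  continuous (fun xp : torus_space b * N => torus_act xp.1 xp.2).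
Proof.
move=> [x p] U Uxp.
have : nbhs (torus_act x p) U by exact: Uxp.
rewrite nbhsE => -[U' [oU' U'xp] UU].
have [xi xE] := torus_proj_repr x; have [z pE] := LVMB_proj_surj p.
have [W oW WP] := LVMB_open_preimage oU'.
have Wz : W (Cact (conj_Lambda Lambda) 1 xi (set_val z)).
  by rewrite -torus_act_coverE; apply/WP; rewrite -torus_actE -xE pE.
have := @exp_action_continuous R[i] m n expC (conj_Lambda Lambda) 1
  continuous_expC (xi, set_val z).
move=> /(_ W) []; first exact: open_nbhs_nbhs.
move=> [A B] /= []; rewrite nbhsE => -[A' [oA' A'xi] AA'].
rewrite nbhsE => -[B' [oB' B'z] BB'] ABW.
have nx : nbhs (x : torus_space b) (torus_proj b @` A').
  by apply: open_nbhs_nbhs; split; [exact: torus_proj_open|exists xi].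
have np : nbhs p (pr @` (set_val @^-1` B')).
  by apply: open_nbhs_nbhs; split; [exact: LVMB_proj_open|exists z].
exists (torus_proj b @` A', pr @` (set_val @^-1` B')); first by split.
move=> [y q] /= [[eta A'eta <-] [w B'w <-]]; apply: UU.
rewrite torus_actE; apply/WP; rewrite torus_act_coverE.
by apply: (ABW (eta, set_val w)); split => /=; [exact: AA'|exact: BB'].
Qed.

Lemma torus_act_continuous1 x : continuous (torus_act x).
Proof.
move=> p; apply: (@continuous_comp _ _ _ (fun q => (x : torus_space b, q))
  (fun xp : torus_space b * N => torus_act xp.1 xp.2));
  last exact: torus_act_continuous.
by apply: continuous_pair; [exact: cst_continuous|move=> q; exact: cvg_id].
Qed.

Lemma torus_act_line_continuous xi p :
  continuous (fun w : R[i] => torus_act (torus_proj b (w *: xi)) p).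
Proof.
move=> w; apply: (@continuous_comp _ _ _
  (fun w : R[i] => (torus_proj b (w *: xi) : torus_space b, p))
  (fun xp : torus_space b * N => torus_act xp.1 xp.2));
  last exact: torus_act_continuous.
apply: continuous_pair; last exact: cst_continuous.
move=> v.
apply: (@continuous_comp _ _ _ (fun w : R[i] => w *: xi)
  (torus_proj b : V -> torus_space b)); last exact: torus_proj_continuous.
exact: (@scalel_continuous R[i] V).
Qed.

End TorusAction.

(** * Holomorphy and fundamental fields *)

Section Velocity.
Context {R : realType} {d : nat}.

(** Velocities use real time and differentials complex increments; this passes from a complex limit
    to a real one. *)
Lemma real_complex_dnbhs0 : (fun h : R => h%:C) @ 0^' --> (0 : R[i])^'.
Proof.
move=> A A0; have : nbhs (0 : R[i]) [set w | w != 0 -> A w] by exact: A0.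
move=> /nbhs_ballP[e /= e0 eA].
have [e' e'0 eE] : exists2 e', 0 < e' & e = e'%:C.
  by case: e e0 {eA} => a b; rewrite ltcE /= => /andP[/eqP -> ?]; exists a.
suff : nbhs (0 : R) [set h | h != 0 -> A h%:C] by [].
apply/nbhs_ballP; exists e' => // h; rewrite /ball /= sub0r normrN => he h0.
apply: eA; last by apply: contra_neq h0 => /complexI.
by rewrite /ball /= sub0r normrN eE normc_def /= expr0n /= addr0 sqrtr_sqr ltcR.
Qed.

Lemma has_velocity_diff (g : R[i] -> 'rV[R[i]]_d) (c : R[i]) :
  differentiable g 0 -> has_velocity (fun t : R => g (t%:C * c)) ('d g 0 c).
Proof.
move=> dg; rewrite /has_velocity.
have -> : (fun h : R => (h^-1)%:C *: (g (h%:C * c) - g (0%:C * c))) =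
    (fun w : R[i] => w^-1 *: (g (w * c) - g 0)) \o (fun h : R => h%:C).
  by apply/funext => h /=; rewrite fmorphV mul0r.
apply: cvg_comp; first exact: real_complex_dnbhs0.
exact: (@difference_quotient_cvg R[i]).
Qed.

Lemma has_velocity_unique (c : R -> 'rV[R[i]]_d) v w :
  has_velocity c v -> has_velocity c w -> v = w.
Proof.
apply: (@cvg_unique 'rV[R[i]]_d); exact: norm_hausdorff.
Qed.

End Velocity.

Section Holomorphy.
Context {R : realType} {m n : nat}.
Local Notation V := 'rV[R[i]]_m.
Variables (eps : {set {set 'I_n}}) (Lambda : 'I_n -> V).
Local Notation N := (LVMB eps Lambda).
Local Notation pr := (@LVMB_proj R m n eps Lambda).
Local Notation S := (set_type (Sset eps : set 'rV[R[i]]_n)).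
Local Notation atlas := (LVMB_atlas eps Lambda).

(** Read in charts, [f] is locally [F \o D \o s]: a local section over the source chart, the lift of
    [f], then the pull-back of the target chart. *)
Lemma LVMB_holomorphic (f : N -> N) (D : 'rV[R[i]]_n -> 'rV[R[i]]_n) :
  continuous f -> (forall z, differentiable D z) ->
  (forall z : S,
     exists2 z' : S, set_val z' = D (set_val z) & f (pr z) = pr z') ->
  holomorphic_map atlas f.
Proof.
move=> fc dD fD; split=> // phi psi [[_ _ phiK phic phiVc] _ sec].
move=> [[psio _ _ _ _] [F HF] _] p pphi fpsi; have [s Hs] := sec p pphi.
set x0 := chart_map phi p in Hs *.
have inv_x0 : chart_inv phi x0 = p by exact: phiK.
(* [F] represents [psi] only over the domain of [psi]; continuity of [f] keeps the image there. *)
have Hdom : \forall x \near x0, chart_dom psi (f (chart_inv phi x)).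
  have c0 : {for x0, continuous (f \o chart_inv phi)}.
    apply: continuous_comp; last exact: fc.
    by apply: phiVc; exists p.
  apply: c0; apply: open_nbhs_nbhs; split => //=.
  by rewrite inv_x0.
have near_eq : \forall x \near x0,
    (chart_map psi \o f \o chart_inv phi) x = (F \o D \o s) x.
  apply: filterS2 Hs Hdom => x [_ [z zE pz]] /=.
  rewrite -pz -zE; have [z' <- ->] := fD z.
  by move=> /HF[-> _].
apply: (near_eq_diff near_eq _).1.
have [ds [z zE pz]] := nbhs_singleton Hs.
have [z' z'E fz'] := fD z.
apply: (@differentiable_comp R[i] _ _ _ s (F \o D)) => //.
apply: (@differentiable_comp R[i] _ _ _ D F) => //.
rewrite -zE -z'E; apply: (HF z' _).2.
by rewrite -fz' pz inv_x0.
Qed.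

Variable b : 'I_(2 * m) -> V.
Hypothesis latticeP : forall x, x \in lattice b <-> acts_trivially Lambda x.

Local Notation rho := (@torus_act R m n eps Lambda b).

Lemma torus_act_holomorphic x : holomorphic_map atlas (rho x).
Proof.
have [xi ->] := torus_proj_repr x.
apply: (@LVMB_holomorphic _ (Cact (conj_Lambda Lambda) 1 xi)).
- exact: torus_act_continuous1.
- by move=> z; exact: (@exp_action_differentiable R[i]).
- move=> z; exists (torus_act_cover Lambda xi z) => //.
  exact: torus_actE.
Qed.

Lemma torus_act_biholomorphism x : biholomorphism atlas (rho x).
Proof.
exists (rho (- x)); split; try exact: torus_act_holomorphic.
- move=> p; rewrite -[LHS]/((rho (- x) \o rho x) p) -torus_actD//.
  by rewrite addNr torus_act0.
- move=> p; rewrite -[LHS]/((rho x \o rho (- x)) p) -torus_actD//.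
  by rewrite subrr torus_act0.
Qed.

(** Time is complex, so that one differential at 0 yields the velocities of all the directions
    [c *: xi]. *)
Definition orbit_chart (xi : V) (phi : @chart R N (n - m - 1)%N) (p : N)
    (w : R[i]) :=
  chart_map phi (rho (torus_proj b (w *: xi)) p).

Lemma torus_act_line0 xi p : rho (torus_proj b ((0 : R[i]) *: xi)) p = p.
Proof. by rewrite scale0r torus_proj0 torus_act0. Qed.

Lemma orbit_chart_dom xi phi p : atlas phi -> chart_dom phi p ->
  \forall w \near (0 : R[i]), chart_dom phi (rho (torus_proj b (w *: xi)) p).
Proof.
move=> [[phio _ _ _ _] _ _] pphi.
apply: (@torus_act_line_continuous _ _ _ _ _ _ latticeP xi p 0).
by apply: open_nbhs_nbhs; split; rewrite ?torus_act_line0.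
Qed.

(** Through a lift [z] of [p], the orbit is [F] applied to an exponential curve in C^n, which is
    holomorphic in [w]. *)
Lemma orbit_chart_differentiable xi phi p : atlas phi -> chart_dom phi p ->
  differentiable (orbit_chart xi phi p) 0.
Proof.
move=> aphi pphi; have Hdom := orbit_chart_dom xi aphi pphi.
case: aphi => _ [F HF] _; have [z pE] := LVMB_proj_surj p.
pose lift (w : R[i]) :=
  exp_action expC (conj_Lambda Lambda) 1 (w *: xi) (set_val z).
have near_eq : \forall w \near (0 : R[i]),
    orbit_chart xi phi p w = (F \o lift) w.
  apply: filterS Hdom => w; rewrite /orbit_chart -pE torus_actE//.
  by move=> /HF[<- _].
apply: (near_eq_diff near_eq _).1.
apply: (@differentiable_comp R[i] _ _ _ lift F).
  apply: (@exp_action_line_differentiable R[i]); exact: differentiable_expC.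
have -> : lift 0 = set_val z.
  by rewrite /lift scale0r; exact: Cact1.
by apply: (HF z _).2; rewrite pE.
Qed.

Definition orbit_field (xi : V) (phi : @chart R N (n - m - 1)%N) (p : N) :
  'rV[R[i]]_(n - m - 1) := 'd (orbit_chart xi phi p) 0 1.

(** The differential is complex-linear, whence the factor [c]; c = 1 gives the field itself and c =
    i its image under [J]. *)
Lemma orbit_field_velocity xi (c : R[i]) phi p : atlas phi -> chart_dom phi p ->
  has_velocity
    (fun t : R => chart_map phi (rho (torus_proj b (t%:C *: (c *: xi))) p))
    (c *: orbit_field xi phi p).
Proof.
move=> aphi pphi.
have := @has_velocity_diff R _ _ c (orbit_chart_differentiable xi aphi pphi).
have -> : (fun t : R => orbit_chart xi phi p (t%:C * c)) =
  (fun t : R => chart_map phi (rho (torus_proj b (t%:C *: (c *: xi))) p)).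
  by apply/funext => t; rewrite /orbit_chart scalerA.
suff -> : 'd (orbit_chart xi phi p) 0 c = c *: orbit_field xi phi p by [].
by rewrite /orbit_field -linearZ /= -[c *: 1]/(c * 1) mulr1.
Qed.

Lemma orbit_field_fundamental xi : fundamental_field atlas rho xi (orbit_field xi).
Proof.
split=> [phi psi aphi apsi p pphi ppsi|phi aphi p pphi]; last first.
  have := @orbit_field_velocity xi 1 phi p aphi pphi.
  by rewrite !scale1r.
(* The transition map is the chart expression of the identity, which lifts to the identity. *)
have tr_diff : differentiable (chart_map psi \o chart_inv phi) (chart_map phi p).
  have [_ hol] : holomorphic_map atlas id.
    by apply: (@LVMB_holomorphic id id) => [x|z|z]; [exact: cvg_id| |exists z].
  exact: hol.
have Hdom := orbit_chart_dom xi aphi pphi.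
have near_eq : \forall w \near (0 : R[i]), orbit_chart xi psi p w =
    (chart_map psi \o chart_inv phi) (orbit_chart xi phi p w).
  apply: filterS Hdom => w wphi; case: (aphi) => -[_ _ phiK _ _] _ _.
  by rewrite /orbit_chart /= phiK.
have dphi := orbit_chart_differentiable xi aphi pphi.
have x0E : orbit_chart xi phi p 0 = chart_map phi p.
  by rewrite /orbit_chart torus_act_line0.
rewrite -x0E in tr_diff; rewrite /orbit_field -x0E.
exact: (@near_eq_diff_comp R[i] _ _ _ _ _ (chart_map psi \o chart_inv phi)).
Qed.

Lemma torus_act_preserved_by_J : preserved_by_J atlas rho.
Proof.
split=> [xi|X [xi [Xvf Xvel]]].
  by exists (orbit_field xi); exact: orbit_field_fundamental.
(* Velocities are unique, so [X] is [orbit_field xi] on chart domains. *)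
have XE phi p : atlas phi -> chart_dom phi p -> X phi p = orbit_field xi phi p.
  move=> aphi pphi; apply: (has_velocity_unique (Xvel _ aphi _ pphi)).
  exact: (orbit_field_fundamental xi).2.
(* The field [J X] is generated by i xi. *)
exists ('i *: xi); split=> [phi psi aphi apsi p pphi ppsi|phi aphi p pphi].
  by rewrite /J (Xvf _ _ aphi apsi _ pphi ppsi) -linearZ.
by rewrite /J XE//; exact: orbit_field_velocity.
Qed.

End Holomorphy.

(** * The quotient of C^m by the kernel as a torus of automorphisms *)

Theorem theorem5p4 (R : realType) (m n : nat)
    (hm : (1 <= m)%N) (hn : (2 * m + 1 <= n)%N)
    (eps : {set {set 'I_n}}) (Lambda : 'I_n -> 'rV[R[i]]_m)
    (hgood : good_system eps Lambda) (hK : condition_K Lambda) :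
  exists b : 'I_(2 * m) -> 'rV[R[i]]_m,
    real_free b /\
    exists rho : torus b -> LVMB eps Lambda -> LVMB eps Lambda,
      torus_in_Aut (LVMB_atlas eps Lambda) rho /\
      preserved_by_J (LVMB_atlas eps Lambda) rho.
Proof.
have [hst _ _] := hgood.
have n0 : (0 < n)%N by rewrite (leq_trans _ hn)// addn1.
have mn : (2 * m <= n)%N by rewrite (leq_trans _ hn)// leq_addr.
(* Any index can serve as the base point [i0]; the first one exists since n > 0. *)
have [b [bfree latP]] := trivial_action_lattice (Ordinal n0) hst hK mn.
exists b; split=> //; exists (@torus_act R m n eps Lambda b).
split; last exact: torus_act_preserved_by_J.
split.
- by move=> x; exact: torus_act_biholomorphism.
- by move=> x y; exact: torus_actD.
- by apply: torus_act_inj => //; case: hst => -[].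
- exact: torus_act_continuous.
Qed.
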